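(* Let $C$ be an algebraically closed field of characteristic zero and let $R$ be a complete local noetherian $C$-algebra with maximal ideal $\mathfrak r$ and residue field $C$. Let $(\mathcal M,\nabla)\in\mathbf{MC}_{\log}(R[[x]]/R)$ be such that $\mathcal M$ is a free $R[[x]]$-module and no two distinct exponents of $\nabla$ differ by an integer. Then $(\mathcal M,\nabla)$ is isomorphic to $eul(\mathcal M/(x),\mathrm{res}_\nabla)$. Otherwise said: consider a differential system $\vartheta\boldsymbol y=A\boldsymbol y$ defined by $A\in\mathrm M_r(R[[x]])$ such that $A(0)$ modulo $\mathfrak r$ has no two distinct eigenvalues differing by an integer. Then there exists $P\in\mathrm{GL}_r(R[[x]])$ such that, writing $\boldsymbol y=P\boldsymbol z$, we arrive at the system $\vartheta\boldsymbol z=B\boldsymbol z$ in which $B\in\mathrm M_r(R)$.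
   Context: $\vartheta(\sum a_nx^n)=\sum na_nx^n$ on $R[[x]]$. $\mathbf{MC}_{\log}(R[[x]]/R)$: pairs $(\mathcal M,\nabla)$ with $\mathcal M$ a finitely generated $R[[x]]$-module and $\nabla:\mathcal M\to\mathcal M$ an $R$-linear map with $\nabla(fm)=\vartheta(f)m+f\nabla(m)$; arrows are $R[[x]]$-linear maps commuting with $\nabla$. The residue $\mathrm{res}_\nabla$ is the $R$-linear endomorphism of $\mathcal M/(x)=\mathcal M/x\mathcal M$ induced by $\nabla$. The exponents of $\nabla$ are the eigenvalues (elements of $C$) of the $C$-linear endomorphism $\overline{\mathrm{res}}_\nabla$ of $\mathcal M/(\mathfrak r,x)\mathcal M$ obtained by reducing $\mathrm{res}_\nabla$ modulo $\mathfrak r$. For a finitely generated $R$-module $V$ and an $R$-linear $A:V\to V$, $eul(V,A)=(R[[x]]\otimes_RV,D_A)$ with $D_A(f\otimes v)=\vartheta(f)\otimes v+f\otimes Av$. *)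

(* Defs.v *)
From HB Require Import structures.
From mathcomp Require Import all_boot all_order all_algebra.
From mathcomp Require Import boolp.

Set Implicit Arguments.
Unset Strict Implicit.
Unset Printing Implicit Defensive.

Import GRing.Theory.
Local Open Scope ring_scope.
Local Open Scope quotient_scope.

Record fps (R : comNzRingType) := Fps { fcoef : nat -> R }.

Section FpsRing.
Variable R : comNzRingType.
Implicit Types f g h : fps R.

Lemma fpsP f g : (forall n, fcoef f n = fcoef g n) -> f = g.
Proof. by case: f g => [f] [g] /= e; congr Fps; exact/funext. Qed.

HB.instance Definition _ := gen_eqMixin (fps R).
HB.instance Definition _ := gen_choiceMixin (fps R).

Definition fps_zero := Fps (fun _ => 0 : R).
Definition fps_opp f := Fps (fun n => - fcoef f n).
Definition fps_add f g := Fps (fun n => fcoef f n + fcoef g n).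

Fact fps_addA : associative fps_add.
Proof. by move=> f g h; apply: fpsP => n /=; rewrite addrA. Qed.
Fact fps_addC : commutative fps_add.
Proof. by move=> f g; apply: fpsP => n /=; rewrite addrC. Qed.
Fact fps_add0 : left_id fps_zero fps_add.
Proof. by move=> f; apply: fpsP => n /=; rewrite add0r. Qed.
Fact fps_addN : left_inverse fps_zero fps_opp fps_add.
Proof. by move=> f; apply: fpsP => n /=; rewrite addNr. Qed.

HB.instance Definition _ := GRing.isZmodule.Build (fps R)
  fps_addA fps_addC fps_add0 fps_addN.

Definition fpsC (a : R) : fps R := Fps (fun n => if n == 0%N then a else 0).
Definition fpsX : fps R := Fps (fun n => (n == 1%N)%:R).
Definition fps_mul f g :=
  Fps (fun n => \sum_(i < n.+1) fcoef f i * fcoef g (n - i)%N).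

Lemma fcoefD f g n : fcoef (f + g) n = fcoef f n + fcoef g n.
Proof. by []. Qed.

(* Truncation, used to transfer the ring axioms from {poly R}. *)
Let trunc k f : {poly R} := \poly_(i < k) fcoef f i.

Fact fps_mul_trunc k f g n : (n < k)%N ->
  fcoef (fps_mul f g) n = (trunc k f * trunc k g)`_n.
Proof.
move=> nk; rewrite coefM; apply: eq_bigr => i _; rewrite !coef_poly.
have ik : (i < k)%N by apply: leq_trans nk; rewrite ltnS -ltnS ltn_ord.
by rewrite ik (leq_ltn_trans (leq_subr _ _) nk).
Qed.

Fact fps_mulA : associative fps_mul.
Proof.
have tM k f g n : (n < k)%N ->
    (trunc k (fps_mul f g))`_n = (trunc k f * trunc k g)`_n.
  by move=> nk; rewrite coef_poly nk (fps_mul_trunc _ _ nk).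
move=> f g h; apply: fpsP => n; rewrite !(@fps_mul_trunc n.+1) //.
transitivity ((trunc n.+1 f * (trunc n.+1 g * trunc n.+1 h))`_n).
  rewrite !coefM; apply: eq_bigr => i _; rewrite tM //.
  by rewrite ltnS leq_subr.
rewrite mulrA !coefM; apply: eq_bigr => i _; rewrite tM //.
Qed.

Fact fps_mulC : commutative fps_mul.
Proof.
by move=> f g; apply: fpsP => n; rewrite !(@fps_mul_trunc n.+1) // mulrC.
Qed.

Lemma fcoefCM a g n : fcoef (fps_mul (fpsC a) g) n = a * fcoef g n.
Proof.
by rewrite /= big_ord_recl /= subn0 big1 ?addr0 // => i _; rewrite mul0r.
Qed.

Fact fps_mul1 : left_id (fpsC 1) fps_mul.
Proof. by move=> f; apply: fpsP => n; rewrite fcoefCM mul1r. Qed.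

Fact fps_mulDl : left_distributive fps_mul +%R.
Proof.
move=> f g h; apply: fpsP => n /=; rewrite -big_split /=.
by apply: eq_bigr => i _; rewrite mulrDl.
Qed.

Fact fps_1_neq0 : fpsC 1 != 0.
Proof.
apply/eqP => /(congr1 (fun f => fcoef f 0)) /= /eqP.
by rewrite oner_eq0.
Qed.

HB.instance Definition _ := GRing.Zmodule_isComNzRing.Build (fps R)
  fps_mulA fps_mulC fps_mul1 fps_mulDl fps_1_neq0.

Lemma fcoefM f g n :
  fcoef (f * g) n = \sum_(i < n.+1) fcoef f i * fcoef g (n - i)%N.
Proof. by []. Qed.

Definition fps_unit : {pred fps R} := fun f => `[< exists g, g * f = 1 >].
Definition fps_inv f : fps R :=
  if pselect (exists g, g * f = 1) is left e then projT1 (cid e) else f.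

Fact fps_mulV : {in fps_unit, left_inverse 1 fps_inv *%R}.
Proof.
move=> f; rewrite unfold_in => /asboolP uf; rewrite /fps_inv.
by case: pselect => // e; case: (cid e).
Qed.
Fact fps_unitP f g : g * f = 1 -> fps_unit f.
Proof. by move=> e; apply/asboolP; exists g. Qed.
Fact fps_inv_out : {in [predC fps_unit], fps_inv =1 id}.
Proof.
move=> f; rewrite inE unfold_in => /asboolPn uf; rewrite /fps_inv.
by case: pselect.
Qed.

HB.instance Definition _ := GRing.ComNzRing_hasMulInverse.Build (fps R)
  fps_mulV fps_unitP fps_inv_out.

Fact fpsC_is_zmod_morphism : zmod_morphism fpsC.
Proof. by move=> a b; apply: fpsP => -[|n] //=; rewrite subr0. Qed.
Fact fpsC_is_monoid_morphism : monoid_morphism fpsC.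
Proof.
split=> // a b; apply: fpsP => n; rewrite [RHS]fcoefCM /=.
by case: eqP => // _; rewrite mulr0.
Qed.
HB.instance Definition _ :=
  GRing.isZmodMorphism.Build R (fps R) fpsC fpsC_is_zmod_morphism.
HB.instance Definition _ :=
  GRing.isMonoidMorphism.Build R (fps R) fpsC fpsC_is_monoid_morphism.

Definition theta f : fps R := Fps (fun n => fcoef f n *+ n).

Fact theta_is_zmod_morphism : zmod_morphism theta.
Proof. by move=> f g; apply: fpsP => n /=; rewrite mulrnBl. Qed.
HB.instance Definition _ :=
  GRing.isZmodMorphism.Build (fps R) (fps R) theta theta_is_zmod_morphism.

Lemma thetaM f g : theta (f * g) = theta f * g + f * theta g.
Proof.
apply: fpsP => n; rewrite fcoefD !fcoefM /= -sumrMnl -big_split /=.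
apply: eq_bigr => i _; rewrite mulrnAl mulrnAr -mulrnDr subnKC //.
by rewrite -ltnS ltn_ord.
Qed.

Lemma thetaC a : theta (fpsC a) = 0.
Proof. by apply: fpsP => -[|n] //=; rewrite mul0rn. Qed.

Lemma thetaX : theta fpsX = fpsX.
Proof. by apply: fpsP => -[|[|n]] //=; rewrite mul0rn. Qed.

Lemma fps_decomp f :
  f = fpsC (fcoef f 0) + fpsX * Fps (fun n => fcoef f n.+1).
Proof.
apply: fpsP => -[|n]; rewrite fcoefD fcoefM /=.
  by rewrite big_ord1 mul0r addr0.
rewrite 2!big_ord_recl /= mul0r !add0r mul1r subn1 big1 ?addr0 // => i _.
by rewrite mul0r.
Qed.

End FpsRing.

Definition restr (R S : nzRingType) (phi : {rmorphism R -> S})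
  (M : lmodType S) : Type := M.

Section Restr.
Variables (R S : nzRingType) (phi : {rmorphism R -> S}) (M : lmodType S).

HB.instance Definition _ := GRing.Zmodule.copy (restr phi M) M.

Definition restr_scale (a : R) (m : restr phi M) : restr phi M :=
  phi a *: (m : M).

Fact restr_scaleA a b m :
  restr_scale a (restr_scale b m) = restr_scale (a * b) m.
Proof. by rewrite /restr_scale scalerA rmorphM. Qed.
Fact restr_scale1 : left_id 1 restr_scale.
Proof. by move=> m; rewrite /restr_scale rmorph1 scale1r. Qed.
Fact restr_scaleDr : right_distributive restr_scale +%R.
Proof. by move=> a m n; rewrite /restr_scale scalerDr. Qed.
Fact restr_scaleDl m : {morph restr_scale^~ m : a b / a + b}.
Proof. by move=> a b; rewrite /restr_scale rmorphD scalerDl. Qed.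

HB.instance Definition _ := GRing.Zmodule_isLmodule.Build R (restr phi M)
  restr_scaleA restr_scale1 restr_scaleDr restr_scaleDl.

Lemma restrZ (a : R) (m : restr phi M) : a *: m = phi a *: (m : M) :> M.
Proof. by []. Qed.

End Restr.

Definition fin_gen (R : nzRingType) (M : lmodType R) : Prop :=
  exists n (e : 'I_n -> M), forall m, exists c : 'I_n -> R,
    m = \sum_(i < n) c i *: e i.

Definition is_basis (R : nzRingType) (M : lmodType R) (B : {pred M}) : Prop :=
  (forall m, exists (s : seq M) (c : M -> R),
     {subset s <= B} /\ m = \sum_(b <- s) c b *: b)
  /\ (forall (s : seq M) (c : M -> R), uniq s -> {subset s <= B} ->
     \sum_(b <- s) c b *: b = 0 -> {in s, forall b, c b = 0}).

Definition free_module (R : nzRingType) (M : lmodType R) : Prop :=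
  exists B : {pred M}, is_basis B.

(* The submodule I M of the finite sums of elements f *: m with f in I.
   It is a submodule for an arbitrary set I since S is commutative. *)
Definition imod (S : comNzRingType) (I : {pred S}) (M : lmodType S) :
    {pred M} :=
  fun m => `[< exists2 s : seq (S * M), all (fun p => p.1 \in I) s
                                  & m = \sum_(p <- s) p.1 *: p.2 >].
Arguments imod [S] I M _.

Section Imod.
Variables (S : comNzRingType) (I : {pred S}) (M : lmodType S).

Lemma imodP (m : M) :
  reflect (exists2 s : seq (S * M), all (fun p => p.1 \in I) s
                              & m = \sum_(p <- s) p.1 *: p.2)
          (m \in imod I M).
Proof. exact: asboolP. Qed.

Lemma imod_gen f (m : M) : f \in I -> f *: m \in imod I M.
Proof. by move=> fI; apply/imodP; exists [:: (f, m)]; rewrite ?big_seq1 //= fI. Qed.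

Fact imod_submod_closed : submod_closed (imod I M).
Proof.
split=> [|a u v /imodP[s sI ->] /imodP[t tI ->]].
  by apply/imodP; exists [::]; rewrite ?big_nil.
apply/imodP; exists ([seq (p.1, a *: p.2) | p <- s] ++ t).
  by rewrite all_cat all_map tI andbT; exact: sI.
rewrite big_cat big_map scaler_sumr; congr (_ + _).
by apply: eq_bigr => p _ /=; rewrite !scalerA mulrC.
Qed.
HB.instance Definition _ :=
  GRing.isSubmodClosed.Build S M (imod I M) imod_submod_closed.

End Imod.

Definition ideal_gen (S : comNzRingType) (G : {pred S}) : {pred S} :=
  imod G S^o.

Lemma mem_ideal_gen (S : comNzRingType) (G : {pred S}) f :
  f \in G -> f \in ideal_gen G.
Proof. by move=> fG; have := @imod_gen S G S^o f 1 fG; rewrite /GRing.scale /= mulr1. Qed.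

Definition subzmod (S : nzRingType) (M : lmodType S) (N : submodClosed M) :
  {pred M} := N.

Fact subzmod_closed (S : nzRingType) (M : lmodType S) (N : submodClosed M) :
  zmod_closed (subzmod N).
Proof. exact: GRing.submod_closedB (submodClosedP N). Qed.
HB.instance Definition _ (S : nzRingType) (M : lmodType S)
    (N : submodClosed M) :=
  GRing.isZmodClosed.Build M (subzmod N) (subzmod_closed N).

Definition quotmod (S : nzRingType) (M : lmodType S) (N : submodClosed M) :
  Type := Quotient.quot (subzmod N).

Section QuotMod.
Variables (S : nzRingType) (M : lmodType S) (N : submodClosed M).
HB.instance Definition _ := Choice.on (quotmod N).
HB.instance Definition _ := GRing.Zmodule.on (quotmod N).

Definition qproj (m : M) : quotmod N := \pi_(Quotient.quot (subzmod N)) m.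

Lemma qproj_eq m n : (qproj m = qproj n) <-> m - n \in N.
Proof.
rewrite -[m - n \in N]/(m - n \in subzmod N) Quotient.idealrBE.
by split=> [e|/eqP]; first exact/eqP.
Qed.

Lemma qproj_repr (q : quotmod N) : qproj (repr (q : Quotient.quot (subzmod N))) = q.
Proof. exact: reprK. Qed.

Lemma qproj_surj (q : quotmod N) : exists m, q = qproj m.
Proof. by exists (repr (q : Quotient.quot (subzmod N))); rewrite qproj_repr. Qed.

Lemma qprojD m n : qproj (m + n) = qproj m + qproj n.
Proof. by rewrite /qproj; exact: (raddfD \pi_(Quotient.quot (subzmod N))). Qed.

Definition qscale (a : S) (q : quotmod N) : quotmod N :=
  qproj (a *: repr (q : Quotient.quot (subzmod N))).

Lemma qscaleE a m : qscale a (qproj m) = qproj (a *: m).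
Proof.
apply/qproj_eq; rewrite -scalerBr rpredZ //; apply/qproj_eq.
exact: qproj_repr.
Qed.

Fact qscaleA a b q : qscale a (qscale b q) = qscale (a * b) q.
Proof. by have [m ->] := qproj_surj q; rewrite !qscaleE scalerA. Qed.
Fact qscale1 : left_id 1 qscale.
Proof. by move=> q; have [m ->] := qproj_surj q; rewrite qscaleE scale1r. Qed.
Fact qscaleDr : right_distributive qscale +%R.
Proof.
move=> a q q'; have [m ->] := qproj_surj q; have [n ->] := qproj_surj q'.
by rewrite -qprojD !qscaleE -qprojD scalerDr.
Qed.
Fact qscaleDl q : {morph qscale^~ q : a b / a + b}.
Proof.
by move=> a b; have [m ->] := qproj_surj q; rewrite !qscaleE -qprojD scalerDl.
Qed.

HB.instance Definition _ := GRing.Zmodule_isLmodule.Build S (quotmod N)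
  qscaleA qscale1 qscaleDr qscaleDl.

Fact qproj_is_linear : linear qproj.
Proof. by move=> a m n; rewrite qprojD -qscaleE. Qed.
HB.instance Definition _ :=
  GRing.isLinear.Build S M (quotmod N) *:%R qproj qproj_is_linear.

(* The endomorphism of M / N induced by one of M, meaningful if N is stable. *)
Definition qinduced (u : M -> M) (q : quotmod N) : quotmod N :=
  qproj (u (repr (q : Quotient.quot (subzmod N)))).

Lemma qinducedE (u : M -> M) : zmod_morphism u ->
  {in N, forall m, u m \in N} -> forall m, qinduced u (qproj m) = qproj (u m).
Proof.
move=> uB uN m; apply/qproj_eq; rewrite -uB; apply: uN.
by apply/qproj_eq; exact: qproj_repr.
Qed.

End QuotMod.

(* Extension of scalars S (x)_R V along phi : R -> S: finite formal sums of
   pairs (f, v) modulo the congruence generated by the tensor relations. *)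
Section Tensor.
Variables (R S : comNzRingType) (phi : {rmorphism R -> S}) (V : lmodType R).

Inductive tens_rel : seq (S * V) -> seq (S * V) -> Prop :=
| TensRefl s : tens_rel s s
| TensSym s t : tens_rel s t -> tens_rel t s
| TensTrans s t u : tens_rel s t -> tens_rel t u -> tens_rel s u
| TensCat s s' t t' : tens_rel s s' -> tens_rel t t' ->
    tens_rel (s ++ t) (s' ++ t')
| TensComm s t : tens_rel (s ++ t) (t ++ s)
| TensZero v : tens_rel [:: (0, v)] [::]
| TensAddl f g v : tens_rel [:: (f + g, v)] [:: (f, v); (g, v)]
| TensAddr f v w : tens_rel [:: (f, v + w)] [:: (f, v); (f, w)]
| TensBal f a v : tens_rel [:: (f * phi a, v)] [:: (f, a *: v)].

Definition tens_equiv : rel (seq (S * V)) := fun s t => `[< tens_rel s t >].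

Fact tens_equiv_is_equiv : equiv_class_of tens_equiv.
Proof.
split=> [s|s t|s t u].
- by apply/asboolP; exact: TensRefl.
- by apply/asboolP/asboolP; exact: TensSym.
- by move=> /asboolP st /asboolP tu; apply/asboolP; exact: TensTrans tu.
Qed.

Canonical tens_equiv_equiv := EquivRelPack tens_equiv_is_equiv.
Canonical tens_equiv_encModRel := defaultEncModRel tens_equiv.

Definition tensor : Type := {eq_quot tens_equiv}.
HB.instance Definition _ := Choice.on tensor.

Definition tens_class (s : seq (S * V)) : tensor := \pi_{eq_quot tens_equiv} s.
Definition tens_repr (t : tensor) : seq (S * V) :=
  repr (t : {eq_quot tens_equiv}).

Lemma tens_reprK t : tens_class (tens_repr t) = t.
Proof. exact: reprK. Qed.

Lemma tens_classP s t : tens_class s = tens_class t <-> tens_rel s t.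
Proof.
split=> [/eqP|st]; last apply/eqP.
  by rewrite /tens_class eqmodE => /asboolP.
by rewrite /tens_class eqmodE; apply/asboolP.
Qed.

Lemma tens_repr_rel s : tens_rel (tens_repr (tens_class s)) s.
Proof. by apply/tens_classP; rewrite tens_reprK. Qed.

Lemma tens_surj t : exists s, t = tens_class s.
Proof. by exists (tens_repr t); rewrite tens_reprK. Qed.

Definition tens_add (t u : tensor) := tens_class (tens_repr t ++ tens_repr u).
Definition tens_scale (f : S) (t : tensor) :=
  tens_class [seq (f * p.1, p.2) | p <- tens_repr t].

Lemma tens_addE s t :
  tens_add (tens_class s) (tens_class t) = tens_class (s ++ t).
Proof. by apply/tens_classP; apply: TensCat; exact: tens_repr_rel. Qed.

Lemma tens_scaleE f s :
  tens_scale f (tens_class s) = tens_class [seq (f * p.1, p.2) | p <- s].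
Proof.
apply/tens_classP; move: (tens_repr _) (tens_repr_rel s) => s'.
elim=> {s s'} /=.
- by move=> s; exact: TensRefl.
- by move=> s t _; exact: TensSym.
- by move=> s t u _ + _; exact: TensTrans.
- by move=> s s' t t' _ ? _ ?; rewrite !map_cat; exact: TensCat.
- by move=> s t; rewrite !map_cat; exact: TensComm.
- by move=> v; rewrite mulr0; exact: TensZero.
- by move=> g h v; rewrite mulrDr; exact: TensAddl.
- by move=> g v w; exact: TensAddr.
- by move=> g a v; rewrite mulrA; exact: TensBal.
Qed.

Fact tens_addA : associative tens_add.
Proof.
move=> t u v; have [? ->] := tens_surj t; have [? ->] := tens_surj u.
by have [? ->] := tens_surj v; rewrite !tens_addE catA.
Qed.
Fact tens_addC : commutative tens_add.
Proof.
move=> t u; have [? ->] := tens_surj t; have [? ->] := tens_surj u.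
by rewrite !tens_addE; apply/tens_classP; exact: TensComm.
Qed.
Fact tens_add0 : left_id (tens_class [::]) tens_add.
Proof. by move=> t; have [? ->] := tens_surj t; rewrite tens_addE. Qed.

Lemma tens_merge f g s :
  tens_rel ([seq (f * p.1, p.2) | p <- s] ++ [seq (g * p.1, p.2) | p <- s])
           [seq ((f + g) * p.1, p.2) | p <- s].
Proof.
elim: s => [|[h v] s IHs] /=; first exact: TensRefl.
rewrite mulrDl; set a := map _ _ in IHs *; set b := map _ _ in IHs *.
set c := map _ _ in IHs *.
apply: TensTrans (TensCat (TensSym (TensAddl _ _ _)) IHs).
apply: (@TensCat [:: _] [:: _] (a ++ [:: (g * h, v)] ++ b)
  ([:: (g * h, v)] ++ a ++ b)); first exact: TensRefl.
by rewrite !catA; apply: TensCat; [exact: TensComm | exact: TensRefl].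
Qed.

Lemma tens_scale0 s : tens_rel [seq (0 * p.1, p.2) | p <- s] [::].
Proof.
elim: s => [|[h v] s IHs] /=; first exact: TensRefl.
by rewrite mul0r -cat1s; apply: (TensCat (TensZero v) IHs).
Qed.

Fact tens_addN : left_inverse (tens_class [::]) (tens_scale (-1)) tens_add.
Proof.
move=> t; have [s ->] := tens_surj t; rewrite tens_scaleE tens_addE.
apply/tens_classP; apply: TensTrans (tens_scale0 s).
rewrite -[X in _ ++ X](map_id s) -(addNr 1).
apply: TensTrans (tens_merge (-1) 1 s); apply: TensCat; first exact: TensRefl.
suff -> : map id s = [seq (1 * p.1, p.2) | p <- s] by exact: TensRefl.
by apply: eq_map => -[f v] /=; rewrite mul1r.
Qed.

HB.instance Definition _ := GRing.isZmodule.Build tensor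
  tens_addA tens_addC tens_add0 tens_addN.

Fact tens_scaleA f g t : tens_scale f (tens_scale g t) = tens_scale (f * g) t.
Proof.
have [s ->] := tens_surj t; rewrite !tens_scaleE -map_comp.
by congr tens_class; apply: eq_map => p /=; rewrite mulrA.
Qed.
Fact tens_scale1 : left_id 1 tens_scale.
Proof.
move=> t; have [s ->] := tens_surj t; rewrite tens_scaleE.
by rewrite -[in RHS](map_id s); congr tens_class; apply: eq_map => -[f v];
  rewrite mul1r.
Qed.
Fact tens_scaleDr : right_distributive tens_scale +%R.
Proof.
move=> f t u; have [? ->] := tens_surj t; have [? ->] := tens_surj u.
rewrite -[_ + _]/(tens_add _ _) -[RHS]/(tens_add _ _).
by rewrite tens_addE !tens_scaleE tens_addE map_cat.
Qed.
Fact tens_scaleDl t : {morph tens_scale^~ t : f g / f + g}.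
Proof.
move=> f g; have [s ->] := tens_surj t; rewrite -[RHS]/(tens_add _ _).
rewrite !tens_scaleE tens_addE; apply/tens_classP; apply: TensSym.
exact: tens_merge.
Qed.

HB.instance Definition _ := GRing.Zmodule_isLmodule.Build S tensor
  tens_scaleA tens_scale1 tens_scaleDr tens_scaleDl.

Definition pure (f : S) (v : V) : tensor := tens_class [:: (f, v)].

Lemma pureDl f g v : pure (f + g) v = pure f v + pure g v.
Proof.
by rewrite -[RHS]/(tens_add _ _) tens_addE; apply/tens_classP; exact: TensAddl.
Qed.
Lemma pureDr f v w : pure f (v + w) = pure f v + pure f w.
Proof.
by rewrite -[RHS]/(tens_add _ _) tens_addE; apply/tens_classP; exact: TensAddr.
Qed.
Lemma pure_bal f a v : pure (f * phi a) v = pure f (a *: v).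
Proof. by apply/tens_classP; exact: TensBal. Qed.
Lemma pure0l v : pure 0 v = 0.
Proof. by apply/tens_classP; exact: TensZero. Qed.
Lemma pureZ f g v : f *: pure g v = pure (f * g) v.
Proof. by rewrite -[LHS]/(tens_scale _ _) tens_scaleE. Qed.
Lemma pure_sumr f n (w : 'I_n -> V) :
  pure f (\sum_(i < n) w i) = \sum_(i < n) pure f (w i).
Proof.
apply: (big_morph _ (pureDr f)).
by rewrite -(scale0r (0 : V)) -pure_bal rmorph0 mulr0 pure0l.
Qed.

Lemma tens_class_sum s : tens_class s = \sum_(p <- s) pure p.1 p.2.
Proof.
elim: s => [|[f v] s IHs]; first by rewrite big_nil.
by rewrite big_cons -IHs -[RHS]/(tens_add _ _) tens_addE.
Qed.

Lemma tensor_ind (P : tensor -> Prop) :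
  P 0 -> (forall f v t, P t -> P (pure f v + t)) -> forall t, P t.
Proof.
move=> P0 PD t; have [s ->] := tens_surj t; rewrite tens_class_sum.
by elim: s => [|p s IHs]; rewrite ?big_nil // big_cons; exact: PD.
Qed.

Definition tens_lift (G : zmodType) (b : S -> V -> G) (t : tensor) : G :=
  \sum_(p <- tens_repr t) b p.1 p.2.

Section Lift.
Variables (G : zmodType) (b : S -> V -> G).
Hypothesis bDl : forall f g v, b (f + g) v = b f v + b g v.
Hypothesis bDr : forall f v w, b f (v + w) = b f v + b f w.
Hypothesis b_bal : forall f a v, b (f * phi a) v = b f (a *: v).

Lemma tens_lift_class s :
  tens_lift b (tens_class s) = \sum_(p <- s) b p.1 p.2.
Proof.
rewrite /tens_lift; move: (tens_repr _) (tens_repr_rel s) => s'.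
elim=> {s s'} //=.
- by move=> s t u _ -> _ ->.
- by move=> s s' t t' _ es _ et; rewrite !big_cat /= es et.
- by move=> s t; rewrite !big_cat /= addrC.
- move=> v; rewrite big_seq1 big_nil /=.
  by apply: (addrI (b 0 v)); rewrite -bDl !addr0.
- by move=> f g v; rewrite !big_cons !big_nil !addr0 /= bDl.
- by move=> f v w; rewrite !big_cons !big_nil !addr0 /= bDr.
- by move=> f a v; rewrite !big_seq1 /= b_bal.
Qed.

Lemma tens_liftE f v : tens_lift b (pure f v) = b f v.
Proof. by rewrite tens_lift_class big_seq1. Qed.

Lemma tens_liftD t u : tens_lift b (t + u) = tens_lift b t + tens_lift b u.
Proof.
have [s ->] := tens_surj t; have [s' ->] := tens_surj u.
by rewrite -[X in tens_lift b X]/(tens_add _ _) tens_addE !tens_lift_class big_cat.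
Qed.

End Lift.

Lemma tensor_fin_gen : fin_gen V -> fin_gen tensor.
Proof.
move=> [n [e eP]]; exists n, (fun i => pure 1 (e i)); apply: tensor_ind.
  by exists (fun=> 0); rewrite big1 // => i _; rewrite scale0r.
move=> f v t [c ->]; have [d ->] := eP v.
exists (fun i => f * phi (d i) + c i); rewrite pure_sumr -big_split /=.
apply: eq_bigr => i _; rewrite scalerDl; congr (_ + _).
by rewrite pureZ mulr1 pure_bal.
Qed.

End Tensor.

Record mclog (R : comNzRingType) := MCLog {
  mc_mod :> lmodType (fps R);
  mc_fin_gen : fin_gen mc_mod;
  nabla : {linear restr (@fpsC R) mc_mod -> restr (@fpsC R) mc_mod};
  nabla_leibniz : forall (f : fps R) (m : mc_mod),
    nabla (f *: m) = theta f *: m + f *: (nabla m : mc_mod) :> mc_mod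
}.

Record mc_hom (R : comNzRingType) (X Y : mclog R) := MCHom {
  mc_map :> {linear X -> Y};
  mc_map_nabla : forall m : X, mc_map (nabla X m) = nabla Y (mc_map m)
}.

Definition mc_iso (R : comNzRingType) (X Y : mclog R) : Prop :=
  exists (u : mc_hom X Y) (v : mc_hom Y X), cancel u v /\ cancel v u.

Section Residue.
Variables (R : comNzRingType) (X : mclog R).

Lemma nablaB : zmod_morphism (nabla X : X -> X).
Proof. exact: (raddfB (nabla X)). Qed.

Lemma imod_stable (I : {pred fps R}) : {in I, forall f, theta f \in I} ->
  {in imod I X, forall m, (nabla X m : X) \in imod I X}.
Proof.
move=> thI m /imodP[s sI ->].
rewrite (raddf_sum (nabla X)); rewrite big_seq.
apply: (@rpred_sum X (imod I X)) => p ps.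
rewrite [X in X \in _](nabla_leibniz p.1 p.2).
by apply: rpredD; apply: imod_gen; rewrite ?thI //; exact: (allP sI).
Qed.

Lemma ideal_gen_stable (G : {pred fps R}) :
  {in G, forall f, theta f \in ideal_gen G} ->
  {in ideal_gen G, forall f, theta f \in ideal_gen G}.
Proof.
move=> thG f /imodP[s sG ->]; rewrite raddf_sum big_seq.
apply: (@rpred_sum _ (imod G (fps R)^o)) => p ps.
rewrite [X in X \in _](thetaM p.1 p.2).
have pG := allP sG _ ps; apply: rpredD; last exact: imod_gen.
by rewrite mulrC; apply: (@rpredZ _ _ (imod G (fps R)^o)); exact: thG.
Qed.

Definition ideal_x : {pred fps R} := ideal_gen (pred1 (fpsX R)).

Lemma ideal_x_stable : {in ideal_x, forall f, theta f \in ideal_x}.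
Proof.
apply: ideal_gen_stable => f; rewrite inE => /eqP ->.
by rewrite thetaX; apply: mem_ideal_gen; rewrite inE.
Qed.

Definition mod_x : lmodType R :=
  restr (@fpsC R) (quotmod (imod ideal_x X)).

Definition proj_x (m : X) : mod_x := qproj (imod ideal_x X) m.

Definition res : mod_x -> mod_x := qinduced (nabla X : X -> X).

Lemma resE m : res (proj_x m) = proj_x (nabla X m).
Proof. exact: (qinducedE nablaB (imod_stable ideal_x_stable)). Qed.

Fact res_is_linear : linear res.
Proof.
move=> a p q; have [m ->] : exists m, p = proj_x m by exact: qproj_surj.
have [n ->] : exists n, q = proj_x n by exact: qproj_surj.
have lin (b : R) (u v : X) :
  b *: proj_x u + proj_x v = proj_x (b *: (u : restr (@fpsC R) X) + v).
  by rewrite /proj_x (linearP (qproj (imod ideal_x X)) (fpsC b) u v).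
by rewrite lin !resE lin; congr proj_x; exact: (linearP (nabla X)).
Qed.
HB.instance Definition _ :=
  GRing.isLinear.Build R mod_x mod_x *:%R res res_is_linear.

Lemma mod_x_fin_gen : fin_gen mod_x.
Proof.
have [n [e eP]] := mc_fin_gen X; exists n, (fun i => proj_x (e i)) => p.
have [m ->] : exists m, p = proj_x m by exact: qproj_surj.
have [c ->] := eP m; exists (fun i => fcoef (c i) 0).
rewrite /proj_x (raddf_sum (qproj (imod ideal_x X))).
apply: eq_bigr => i _; rewrite [LHS](_ : _ = qproj (imod ideal_x X)
  (fpsC (fcoef (c i) 0) *: e i)); first by rewrite linearZ.
apply/qproj_eq; rewrite -scalerBl.
have -> : c i - fpsC (fcoef (c i) 0) = fpsX R * Fps (fun n => fcoef (c i) n.+1).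
  by rewrite {1}(fps_decomp (c i)) addrC addKr.
rewrite -scalerA; apply: imod_gen; apply: mem_ideal_gen; exact: eqxx.
Qed.

End Residue.
Arguments res [R] X p : rename.

Section Eul.
Variables (R : comNzRingType) (V : lmodType R) (A : {linear V -> V}).

Local Notation T := (tensor (@fpsC R) V).

Definition eul_nabla : restr (@fpsC R) T -> restr (@fpsC R) T :=
  tens_lift (fun f v => pure (@fpsC R) (theta f) v + pure (@fpsC R) f (A v)).

Let b f v : T := pure (@fpsC R) (theta f) v + pure (@fpsC R) f (A v).
Let bDl f g v : b (f + g) v = b f v + b g v.
Proof. by rewrite /b raddfD !pureDl addrACA. Qed.
Let bDr f v w : b f (v + w) = b f v + b f w.
Proof. by rewrite /b raddfD !pureDr addrACA. Qed.
Let b_bal f a v : b (f * fpsC a) v = b f (a *: v).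
Proof. by rewrite /b thetaM thetaC mulr0 addr0 !pure_bal linearZ. Qed.

Lemma eul_nablaE f v : eul_nabla (pure (@fpsC R) f v) =
  pure (@fpsC R) (theta f) v + pure (@fpsC R) f (A v).
Proof. exact: tens_liftE bDl bDr b_bal f v. Qed.

Lemma eul_nablaD (t u : T) : eul_nabla (t + u) = eul_nabla t + eul_nabla u.
Proof. exact: tens_liftD bDl bDr b_bal t u. Qed.

Lemma eul_nabla_leibniz (f : fps R) (t : T) :
  eul_nabla (f *: t) = theta f *: t + f *: (eul_nabla t : T) :> T.
Proof.
elim/tensor_ind: t => [|g v t IHt].
  have e0 : eul_nabla (0 : T) = 0.
    by apply: (addrI (eul_nabla (0 : T))); rewrite -eul_nablaD !addr0.
  by rewrite !scaler0 e0 scaler0 addr0.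
rewrite scalerDr !eul_nablaD IHt pureZ !eul_nablaE !scalerDr !pureZ.
rewrite thetaM pureDl -!addrA; congr (_ + _).
by rewrite [RHS]addrCA; congr (_ + _); rewrite [RHS]addrCA.
Qed.

Fact eul_nabla_is_linear : linear eul_nabla.
Proof.
move=> a t u; rewrite eul_nablaD; congr (_ + _).
by rewrite [LHS](eul_nabla_leibniz (fpsC a) t) thetaC scale0r add0r.
Qed.
HB.instance Definition _ := GRing.isLinear.Build R
  (restr (@fpsC R) T) (restr (@fpsC R) T) *:%R eul_nabla eul_nabla_is_linear.

Definition eul (fgV : fin_gen V) : mclog R :=
  @MCLog R T (tensor_fin_gen _ fgV) eul_nabla eul_nabla_leibniz.

End Eul.

Section Ideals.
Variable R : comNzRingType.
Implicit Types I : {pred R}.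

(* [idealr_closed] is the predicate of proper ideals. *)
Definition maximal_ideal I : Prop := idealr_closed I /\
  forall J : {pred R}, idealr_closed J -> {subset I <= J} -> J =i I.

Definition local_ring_with I : Prop :=
  maximal_ideal I /\ forall J : {pred R}, maximal_ideal J -> J =i I.

Definition noetherian_ring : Prop :=
  forall I : {pred R^o}, submod_closed I ->
  exists n (g : 'I_n -> R), forall a, a \in I <->
    exists c : 'I_n -> R, a = \sum_(i < n) c i * g i.

Fixpoint ideal_pow I (n : nat) : {pred R} :=
  if n is n'.+1 then
    ideal_gen (fun c => `[< exists a b,
      [/\ a \in I, b \in ideal_pow I n' & c = a * b] >])
  else predT.

(* R -> lim_n R / I^n is bijective. *)
Definition adically_complete I : Prop :=
  forall u : nat -> R, (forall n, u n.+1 - u n \in ideal_pow I n) ->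
  exists! l : R, forall n, l - u n \in ideal_pow I n.

End Ideals.

Section Residues.
Variables (C : fieldType) (R : comAlgType C) (r : {pred R}).

(* C -> R / r is bijective. *)
Definition residue_field_is_base : Prop :=
  forall a : R, exists! c : C, a - c%:A \in r.

(* The resulting reduction R -> R / r = C. *)
Definition reduce (a : R) : C :=
  if pselect (exists c : C, a - c%:A \in r) is left e then projT1 (cid e)
  else 0.

Definition ideal_rx : {pred fps R} :=
  ideal_gen (fun f => `[< f = fpsX R \/ exists2 a, a \in r & f = fpsC a >]).

Lemma ideal_rx_stable : {in ideal_rx, forall f, theta f \in ideal_rx}.
Proof.
apply: ideal_gen_stable => f fG; have /asboolP[fX|[a _ ->]] := fG.
  by move: fG; rewrite fX thetaX; exact: mem_ideal_gen.
by rewrite thetaC; exact: (rpred0 (imod _ (fps R)^o)).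
Qed.

Variable X : mclog R.

Definition mod_rx : lmodType C :=
  restr (@fpsC R \o in_alg R) (quotmod (imod ideal_rx X)).

Definition proj_rx (m : X) : mod_rx := qproj (imod ideal_rx X) m.

Definition res_bar : mod_rx -> mod_rx := qinduced (nabla X : X -> X).

Lemma res_barE m : res_bar (proj_rx m) = proj_rx (nabla X m).
Proof. exact: (qinducedE (nablaB (X := X)) (imod_stable ideal_rx_stable)). Qed.

Fact res_bar_is_linear : linear res_bar.
Proof.
move=> c p q; have [m ->] : exists m, p = proj_rx m by exact: qproj_surj.
have [n ->] : exists n, q = proj_rx n by exact: qproj_surj.
have lin (b : C) (u v : X) :
  b *: proj_rx u + proj_rx v = proj_rx (b%:A *: (u : restr (@fpsC R) X) + v).
  by rewrite /proj_rx (linearP (qproj (imod ideal_rx X)) (fpsC b%:A) u v).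
by rewrite lin !res_barE lin; congr proj_rx; exact: (linearP (nabla X)).
Qed.
HB.instance Definition _ :=
  GRing.isLinear.Build C mod_rx mod_rx *:%R res_bar res_bar_is_linear.

(* The surjection M / (x) -> M / (r, x) M, along which [res_bar] is the
   reduction of [res], by [res_bar_red]. *)
Definition red_x (p : mod_x X) : mod_rx :=
  proj_rx (repr (p : Quotient.quot (subzmod (imod (@ideal_x R) X)))).

Lemma red_xE m : red_x (proj_x m) = proj_rx m.
Proof.
apply/qproj_eq; set n := repr _.
have : n - m \in imod (@ideal_x R) X by apply/qproj_eq; exact: qproj_repr.
case/imodP=> s sI ->; rewrite big_seq.
apply: (@rpred_sum X (imod ideal_rx X)) => p ps; apply: imod_gen.
have /imodP[t tX ->] := allP sI _ ps; rewrite big_seq.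
apply: (@rpred_sum _ (imod _ (fps R)^o)) => q qt; apply: imod_gen.
by apply/asboolP; left; exact/eqP/(allP tX).
Qed.

Lemma res_bar_red (p : mod_x X) : res_bar (red_x p) = red_x (res X p).
Proof.
have [m ->] : exists m, p = proj_x m by exact: qproj_surj.
by rewrite resE !red_xE res_barE.
Qed.

Definition is_eigenvalue (V : lmodType C) (u : V -> V) (c : C) : Prop :=
  exists2 v : V, v != 0 & u v = c *: v.

Definition exponent (c : C) : Prop := is_eigenvalue res_bar c.

End Residues.

Definition no_integer_gap (C : fieldType) (P : C -> Prop) : Prop :=
  forall c d, P c -> P d -> c <> d -> ~ exists n : int, c - d = n%:~R.

(* The matrix B of the system theta z = B z obtained from theta y = A y by
   y = P z: theta P * z + P * theta z = A * P * z. *)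
Definition gauge (R : comNzRingType) n (A P : 'M[fps R]_n) : 'M[fps R]_n :=
  invmx P *m (A *m P - map_mx (@theta R) P).

Lemma theta_mulmx (R : comNzRingType) m n p (A : 'M[fps R]_(m, n))
    (B : 'M[fps R]_(n, p)) : map_mx (@theta R) (A *m B) =
  map_mx (@theta R) A *m B + A *m map_mx (@theta R) B.
Proof.
apply/matrixP => i j; rewrite !mxE raddf_sum -big_split /=.
by apply: eq_bigr => k _; rewrite !mxE thetaM.
Qed.

Lemma gaugeP (R : comNzRingType) n (A P : 'M[fps R]_n) (z : 'cV[fps R]_n) :
  P \in unitmx ->
  map_mx (@theta R) (P *m z) = A *m (P *m z) <->
  map_mx (@theta R) z = gauge A P *m z.
Proof.
move=> uP; rewrite theta_mulmx /gauge -mulmxA mulmxBl -mulmxA.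
split=> [<-|->]; first by rewrite addrC addKr mulKmx.
by rewrite mulKVmx // addrC subrK.
Qed.

(* Main.v *)
From HB Require Import structures.
Require Import Defs.
From mathcomp Require Import all_boot all_order all_algebra.
From mathcomp Require Import boolp.

Set Implicit Arguments.
Unset Strict Implicit.
Unset Printing Implicit Defensive.

Import GRing.Theory.
Local Open Scope ring_scope.

(** Let [A0] be the constant term of [A]. A gauge matrix [P = 1 + P_1 x + ...]
    carries [theta y = A y] to the constant system [theta z = A0 z] exactly when
    [theta P = A P - P A0]. Comparing coefficients of [x^k] turns this into the
    Sylvester equations
      [k P_k - A0 P_k + P_k A0 = A_1 P_(k-1) + ... + A_k P_0],
    so everything rests on solving [X (A0 + k) - A0 X = Y] over [R] for every
    [k > 0]. This is a square linear system over [R]; its determinant is a unit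
    as soon as its reduction to the residue field is nonzero, because [R] is
    local. Over the residue field the operator is injective: if [A X = X B] then
    [p(A) X = X p(B)] for every polynomial [p], and taking for [p] the
    characteristic polynomial of [A] kills the left side, while [p(B)] is
    invertible when [A] and [B] have no common eigenvalue ([sylvester_inj]).
    Here [A] is [A0] and [B] is [A0 + k], and these have disjoint spectra since
    no two exponents differ by the nonzero integer [k]. The result is
    [gauge_to_const].

    That elements outside the maximal ideal are units comes from completeness:
    such an element is a nonzero scalar times [1 - m] with [m] in the ideal, and
    the geometric series inverts [1 - m] ([exists_inverse_1B]).

    For a free module, finite generation makes the basis finite
    ([fin_free_basis]), and in that basis the connection is given by a matrix
    [A]; the eigenvalues of the reduction of [A0] are exponents
    ([eigenvalue_exponent]). The gauge matrix provides a new basis on which the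
    connection has constant coefficients ([constant_basis]). A module with
    such a basis [e] is an Euler module: [e_i |-> 1 (x) (e_i mod x)] is
    the isomorphism ([constant_connection_eul]). *)

(** * Sylvester equations over an algebraically closed field *)

(** An intertwiner [X] satisfies [p(A) X = X p(B)]. For [p] the characteristic
    polynomial of [A] the left side vanishes by Cayley-Hamilton, and [p(B)] is
    a product of invertible matrices [B - a], with [a] an eigenvalue of [A]. *)
Lemma sylvester_inj (F : closedFieldType) m n (A : 'M[F]_m) (B : 'M[F]_n) :
    (forall a, eigenvalue A a -> ~~ eigenvalue B a) ->
  forall X : 'M[F]_(m, n), A *m X = X *m B -> X = 0.
Proof.
case: m A => [|m] A; first by move=> _ X _; rewrite [X]flatmx0.
case: n B => [|n] B; first by move=> _ X _; rewrite [X]thinmx0.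
move=> AB X AX.
have hX p : horner_mx A p *m X = X *m horner_mx B p.
  elim/poly_ind: p => [|p c IHp]; first by rewrite !rmorph0 mul0mx mulmx0.
  rewrite !rmorphD !rmorphM /= !horner_mx_X !horner_mx_C mulmxDl mulmxDr.
  by rewrite -mulmxA AX mulmxA IHp -mulmxA scalar_mxC.
have [s sP] := closed_field_poly_normal (char_poly A).
have {sP}charA : char_poly A = \prod_(a <- s) ('X - a%:P).
  by rewrite {1}sP (monicP (char_poly_monic A)) scale1r.
have uB : horner_mx B (char_poly A) \in unitmx.
  rewrite charA rmorph_prod big_seq /=.
  apply: (big_ind (fun M => M \in unitmx)) => [|M N uM uN|a sa].
  - exact: unitmx1.
  - by rewrite unitmx_mul uM.
  have : ~~ eigenvalue B a.
    by apply: AB; rewrite eigenvalue_root_char charA root_prod_XsubC.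
  rewrite rmorphB /= horner_mx_X horner_mx_C /eigenvalue /eigenspace negbK.
  by rewrite kermx_eq0 row_free_unit.
have := hX (char_poly A); rewrite Cayley_Hamilton mul0mx => /esym X0.
by rewrite -(mulmxK uB X) X0 mul0mx.
Qed.

(** * Power series and matrices of power series *)

(** Both the inverse of a power series and the gauge matrix have coefficients
    determined by all of the previous ones. *)
Lemma course_of_values (T : Type) (t : T) (F : nat -> (nat -> T) -> T) :
    (forall n u v, (forall k, (k < n)%N -> u k = v k) -> F n u = F n v) ->
  exists u, forall n, u n = F n u.
Proof.
move=> Floc; pose g n := iter n (fun u k => F k u) (fun=> t).
have gS n k : g n.+1 k = F k (g n) by [].
(* After more than [k] rounds of approximation the value at [k] is final. *)
have g_stable k : forall m n, (k < m)%N -> (k < n)%N -> g m k = g n k.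
  elim/ltn_ind: k => k IHk [|m] [|n] //; rewrite !ltnS !gS => km kn.
  by apply: Floc => i ik; apply: IHk => //; apply: leq_trans ik _.
exists (fun n => g n.+1 n) => n; rewrite gS; apply: Floc => k kn.
exact: g_stable.
Qed.

Definition const_coef (R : comNzRingType) (f : fps R) : R := fcoef f 0.

Section ConstCoef.
Variable R : comNzRingType.

Fact const_coef_is_zmod_morphism : zmod_morphism (@const_coef R).
Proof. by []. Qed.
Fact const_coef_is_monoid_morphism : monoid_morphism (@const_coef R).
Proof. by split=> // f g; rewrite /const_coef fcoefM big_ord1. Qed.
HB.instance Definition _ := GRing.isZmodMorphism.Build (fps R) R
  (@const_coef R) const_coef_is_zmod_morphism.
HB.instance Definition _ := GRing.isMonoidMorphism.Build (fps R) R
  (@const_coef R) const_coef_is_monoid_morphism.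

Lemma fps_unit_const1 (f : fps R) : const_coef f = 1 -> f \is a GRing.unit.
Proof.
move=> f0; pose F n (u : nat -> R) :=
  (n == 0%N)%:R - \sum_(i < n) fcoef f i.+1 * u (n - i.+1)%N.
have [|u uE] := @course_of_values R 0 F.
  move=> n u v uv; rewrite /F; congr (_ - _); apply: eq_bigr => i _.
  by rewrite uv // ltn_subrL /= (leq_ltn_trans _ (ltn_ord i)).
apply/unitrPr; exists (Fps u); apply: fpsP => n.
rewrite fcoefM big_ord_recl /= -/(const_coef f) f0 mul1r subn0 uE /F.
by rewrite subrK; case: n.
Qed.

Lemma unitmx_const1 n (P : 'M[fps R]_n) :
  map_mx (@const_coef R) P = 1%:M -> P \in unitmx.
Proof.
by move=> P0; apply/fps_unit_const1; rewrite -det_map_mx P0 det1.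
Qed.

Definition mxcoef m n k (A : 'M[fps R]_(m, n)) : 'M[R]_(m, n) :=
  map_mx (fun f => fcoef f k) A.

Lemma mxcoefM m n p k (A : 'M[fps R]_(m, n)) (B : 'M[fps R]_(n, p)) :
  mxcoef k (A *m B) = \sum_(i < k.+1) mxcoef i A *m mxcoef (k - i) B.
Proof.
apply/matrixP => a b; rewrite !mxE summxE.
under [RHS]eq_bigr do rewrite mxE; rewrite exchange_big /=.
rewrite (big_morph (fun f : fps R => fcoef f k) (id1 := 0) (op1 := +%R)) //.
by apply: eq_bigr => j _; rewrite fcoefM; apply: eq_bigr => i _; rewrite !mxE.
Qed.

Lemma mxcoefP m n (A B : 'M[fps R]_(m, n)) :
  (forall k, mxcoef k A = mxcoef k B) -> A = B.
Proof.
move=> AB; apply/matrixP => i j; apply: fpsP => k.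
by have /matrixP/(_ i j) := AB k; rewrite !mxE.
Qed.

(** The coefficient of [x^k] in [theta P = A P - P A0] is an equation for [P_k]
    whose right-hand side involves only [P_0, ..., P_(k-1)]; for [k = 0] it
    holds with [P_0 = 1]. *)
Lemma gauge_recursion n (A : 'M[fps R]_n) :
    let A0 := mxcoef 0 A in
    (forall k Y, exists X, X *+ k.+1 - A0 *m X + X *m A0 = Y) ->
  exists2 P, mxcoef 0 P = 1%:M &
    map_mx (@theta R) P = A *m P - P *m map_mx (@fpsC R) A0.
Proof.
move=> A0 /= solve.
have [S SE] : exists S : nat -> 'M[R]_n -> 'M[R]_n, forall k Y,
    S k Y *+ k.+1 - A0 *m S k Y + S k Y *m A0 = Y.
  have [S SE] := choice (fun kY => solve kY.1 kY.2).
  by exists (fun k Y => S (k, Y)) => k Y; exact: SE (k, Y).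
pose F k (u : nat -> 'M[R]_n) := if k is j.+1 then
  S j (\sum_(i < j.+1) mxcoef i.+1 A *m u (j - i)%N) else 1%:M.
have [|u uE] := @course_of_values _ 0 F.
  case=> //= j u v uv; congr S; apply: eq_bigr => i _.
  by rewrite uv // ltnS leq_subr.
pose P : 'M[fps R]_n := \matrix_(i, j) Fps (fun k => u k i j).
have PE k : mxcoef k P = u k by apply/matrixP => i j; rewrite !mxE.
exists P; first by rewrite PE uE.
apply: mxcoefP => k.
have -> : mxcoef k (map_mx (@theta R) P) = u k *+ k.
  apply/matrixP => i j; rewrite mulmxnE -PE !mxE //.
have -> : mxcoef k (A *m P - P *m map_mx (@fpsC R) A0) =
    mxcoef k (A *m P) - mxcoef k (P *m map_mx (@fpsC R) A0).
  by apply/matrixP => i j; rewrite !mxE.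
have -> : mxcoef k (P *m map_mx (@fpsC R) A0) = u k *m A0.
  rewrite mxcoefM big_ord_recr /= subnn big1 => [|i _].
    by rewrite add0r PE; congr (_ *m _); apply/matrixP => i j; rewrite !mxE.
  rewrite [X in _ *m X](_ : _ = 0) ?mulmx0 //; apply/matrixP => a b.
  by rewrite !mxE /= subn_eq0 leqNgt ltn_ord.
rewrite mxcoefM big_ord_recl /= subn0 PE -/A0.
case: k => [|k]; first by rewrite big_ord0 uE mulmx1 mul1mx addr0 subrr mulr0n.
under eq_bigr do rewrite PE /bump subSS.
have := SE k (\sum_(i < k.+1) mxcoef i.+1 A *m u (k - i)%N).
rewrite -[S k _]/(F k.+1 u) -uE => <-.
by rewrite addrA addrK [RHS]addrC subrK.
Qed.

End ConstCoef.
Arguments const_coef {R} f.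

(** * Sylvester equations over a local ring *)

Section LocalMorphism.
Variables (F : closedFieldType) (R : comNzRingType) (phi : {rmorphism R -> F}).
Hypothesis phi_local : forall a, phi a != 0 -> exists b, a * b = 1.

Lemma local_mx_inv n (M : 'M[R]_n) :
  map_mx phi M \in unitmx -> exists N, N *m M = 1%:M.
Proof.
rewrite unitmxE det_map_mx unitfE => /phi_local[b bP].
exists (b *: \adj M).
by rewrite -scalemxAl mul_adj_mx -mul_scalar_mx -scalar_mxM mulrC bP.
Qed.

(** The operator [X |-> X B - A X] is a square matrix over [R], and its reduction
    is the analogous operator over the field. The latter is injective, hence
    invertible, and invertibility lifts. *)
Lemma sylvester_surj m n (A : 'M[R]_m) (B : 'M[R]_n) :
    (forall a, eigenvalue (map_mx phi A) a -> ~~ eigenvalue (map_mx phi B) a) ->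
  forall Y : 'M[R]_(m, n), exists X, X *m B - A *m X = Y.
Proof.
move=> AB Y.
pose f : 'M[R]_(m, n) -> 'M[R]_(m, n) := mulmxr B \- mulmx A.
pose M := lin_mx (mulmxr B) - lin_mx (mulmx A) : 'M[R]_(m * n).
have ME X : mxvec X *m M = mxvec (X *m B - A *m X).
  by rewrite mulmxBr !mul_vec_lin linearB.
have [N NM] : exists N, N *m M = 1%:M.
  apply: local_mx_inv; rewrite -row_free_unit -kermx_eq0.
  apply/rowV0P => v /sub_kermxP; rewrite -[v]vec_mxK; set X := vec_mx v.
  have -> : map_mx phi M =
      lin_mx (mulmxr (map_mx phi B)) - lin_mx (mulmx (map_mx phi A)).
    rewrite map_mxB; congr (_ - _); apply: map_lin_mx => Z /=.
      by rewrite map_mxM.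
    by rewrite map_mxM.
  rewrite mulmxBr !mul_vec_lin -linearB /= => /(congr1 vec_mx).
  rewrite mxvecK linear0 => /eqP; rewrite subr_eq0 => /eqP/esym XAB.
  by rewrite (sylvester_inj AB XAB) linear0.
exists (vec_mx (mxvec Y *m N)).
by rewrite -[LHS]mxvecK -ME vec_mxK -mulmxA NM mulmx1 mxvecK.
Qed.

Hypothesis charF : [pchar F] =i pred0.

(** A common eigenvalue [a] of [A0] and [A0 + k], [k > 0], would give the two
    eigenvalues [a] and [a - k] of [A0], distinct in characteristic zero. *)
Lemma gauge_to_const n (A : 'M[fps R]_n) :
    no_integer_gap (eigenvalue (map_mx phi (mxcoef 0 A))) ->
  exists2 P, P \in unitmx &
    map_mx (@theta R) P = A *m P - P *m map_mx (@fpsC R) (mxcoef 0 A).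
Proof.
move=> gapA; case: (@gauge_recursion R n A) => [k Y|P P0 dP]; last first.
  by exists P => //; apply: unitmx_const1.
set A0 := mxcoef 0 A in gapA *.
have [|X <-] := @sylvester_surj n n A0 (A0 + k.+1%:R%:M) _ Y.
  move=> a Aa; apply/negP => /eigenvalueP[v].
  rewrite map_mxD map_scalar_mx rmorph_nat mulmxDr mul_mx_scalar => va v0.
  have Aak : eigenvalue (map_mx phi A0) (a - k.+1%:R).
    by apply/eigenvalueP; exists v; rewrite // scalerBl -va addrK.
  apply: (gapA a (a - k.+1%:R) Aa Aak); last first.
    by exists k.+1%:Z; rewrite opprB addrC subrK.
  move=> /(congr1 (fun c => a - c)) /eqP; rewrite subrr opprB addrC subrK eq_sym.
  by have /pcharf0P-> := charF.
exists X; rewrite mulmxDr mul_mx_scalar scaler_nat.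
by rewrite addrAC; congr (_ - _); exact: addrC.
Qed.

End LocalMorphism.

(** * Finite bases *)

Section Combination.
Variables (S : comNzRingType) (M : lmodType S).

Definition comb n (e : 'I_n -> M) (c : 'rV[S]_n) : M :=
  \sum_(i < n) c 0 i *: e i.

Fact comb_is_linear n (e : 'I_n -> M) : linear (comb e).
Proof.
move=> a c d; rewrite /comb scaler_sumr -big_split /=.
by apply: eq_bigr => i _; rewrite !mxE scalerDl scalerA.
Qed.
HB.instance Definition _ n (e : 'I_n -> M) :=
  GRing.isLinear.Build S 'rV[S]_n M *:%R (comb e) (comb_is_linear e).

Lemma comb_mulmx n p (e : 'I_p -> M) (c : 'rV_n) (A : 'M_(n, p)) :
  comb e (c *m A) = comb (fun i => comb e (row i A)) c.
Proof.
rewrite mulmx_sum_row linear_sum; apply: eq_bigr => i _.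
by rewrite linearZ.
Qed.

Lemma comb_delta n (e : 'I_n -> M) i : comb e (delta_mx 0 i) = e i.
Proof.
rewrite /comb (bigD1 i) //= big1 => [|j ji]; last first.
  by rewrite mxE (negPf ji) andbF scale0r.
by rewrite mxE !eqxx scale1r addr0.
Qed.

(** Finitely many generators involve only finitely many elements of a basis, and
    these already generate. *)
Lemma fin_free_basis : fin_gen M -> free_module M ->
  exists n (e : 'I_n -> M), bijective (comb e).
Proof.
move=> [k [g gP]] [B [Bspan Bfree]].
have [s sP] := choice Bspan.
pose t := undup (flatten [seq s (g i) | i <- enum 'I_k]).
have tB : {subset t <= B}.
  move=> b; rewrite mem_undup => /flattenP[_ /mapP[i _ ->]].
  by have [c [+ _]] := sP (g i); exact.
pose span m := exists c : 'rV_(size t), m = comb (tnth (in_tuple t)) c.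
have spanD m1 m2 : span m1 -> span m2 -> span (m1 + m2).
  by move=> [c ->] [d ->]; exists (c + d); rewrite raddfD.
have spanZ a m1 : span m1 -> span (a *: m1).
  by move=> [c ->]; exists (a *: c); rewrite linearZ.
have span0 : span 0 by exists 0; rewrite raddf0.
have span_t b : b \in t -> span b.
  move=> bt; have [i ->] := seq_tnthP (bt : b \in in_tuple t).
  by exists (delta_mx 0 i); rewrite comb_delta.
have spanT m : span m.
  have [c ->] := gP m; apply: (big_ind span) => // i _; apply: (spanZ).
  have [d [_ ->]] := sP (g i); rewrite big_seq; apply: (big_ind span) => // b bs.
  apply/spanZ/span_t; rewrite mem_undup; apply/flattenP.
  by exists (s (g i)) => //; apply: map_f; rewrite mem_enum.
have [co coP] := choice spanT.
exists (size t), (tnth (in_tuple t)), co => [c|m]; last by rewrite -coP.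
apply/eqP; rewrite -subr_eq0; set d := _ - c.
have d0 : comb (tnth (in_tuple t)) d = 0 by rewrite raddfB /= -coP subrr.
pose w (b : M) := if insub (index b t) is Some i then d 0 i else 0.
have wE (i : 'I_(size t)) : w (tnth (in_tuple t) i) = d 0 i.
  by rewrite /w (tnth_nth 0) index_uniq ?undup_uniq // valK.
apply/eqP/rowP => i; rewrite -wE mxE.
apply: (Bfree t) => //; rewrite ?undup_uniq ?mem_tnth //.
by rewrite big_tnth -[RHS]d0; apply: eq_bigr => j _; rewrite wE.
Qed.

End Combination.

Lemma mem_ideal_gen_mul (S : comNzRingType) (G : {pred S}) f g :
  g \in G -> f * g \in ideal_gen G.
Proof.
by move=> gG; apply: (@rpredZ _ _ (imod G S^o)); exact: mem_ideal_gen.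
Qed.

(** Membership in [I M] is tested on coordinates; this is what makes [M / I M]
    computable from a basis, for both ideals [(x)] and [(r, x)]. *)
Lemma mem_imod_basis (S : comNzRingType) (G : {pred S}) (M : lmodType S)
    n (e : 'I_n -> M) (coord : M -> 'rV[S]_n) :
    cancel (comb e) coord -> cancel coord (comb e) ->
  forall m,
    (m \in imod (ideal_gen G) M) = [forall i, coord m 0 i \in ideal_gen G].
Proof.
move=> eK cK m; apply/idP/forallP => [/imodP[s sI ->] i|mI]; last first.
  by rewrite -[m]cK; apply: rpred_sum => i _; apply: imod_gen.
have coordL : linear coord := can2_linear (f := comb e) eK cK.
pose cl : {linear M -> 'rV[S]_n} :=
  HB.pack coord (GRing.isLinear.Build _ _ _ _ coord coordL).
rewrite -[coord _]/(cl _) linear_sum summxE big_seq.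
apply: (@rpred_sum _ (imod G S^o)) => p ps; rewrite linearZ mxE mulrC.
by apply: (@rpredZ _ _ (imod G S^o)); exact: (allP sI).
Qed.

Lemma fpsX_dvd (R : comNzRingType) (f : fps R) : const_coef f = 0 ->
  f = Fps (fun n => fcoef f n.+1) * fpsX R.
Proof.
move=> f0; rewrite {1}(fps_decomp f) -/(const_coef f) f0 rmorph0 add0r.
by rewrite mulrC.
Qed.

Lemma mem_ideal_x (R : comNzRingType) (f : fps R) :
  (f \in @ideal_x R) = (const_coef f == 0).
Proof.
apply/idP/eqP => [/imodP[s sX ->]|f0]; last first.
  by rewrite (fpsX_dvd f0); apply: mem_ideal_gen_mul; exact: eqxx.
rewrite raddf_sum big_seq big1 // => p ps.
rewrite [LHS](rmorphM const_coef p.1 p.2) (eqP (allP sX _ ps)).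
exact: mul0r.
Qed.

(** * Connections that are constant on a basis *)

Lemma mc_iso_of_inverse (R : comNzRingType) (X Y : mclog R)
    (u : {linear X -> Y}) (v : Y -> X) :
    (forall m : X, u (nabla X m) = nabla Y (u m)) ->
  cancel u v -> cancel v u -> mc_iso X Y.
Proof.
move=> u_nabla uK vK.
pose vl : {linear Y -> X} :=
  HB.pack v (GRing.isLinear.Build _ _ _ _ v (can2_linear uK vK)).
have v_nabla (m : Y) : vl (nabla Y m) = nabla X (vl m).
  by apply: (can_inj uK); rewrite u_nabla /= !vK.
by exists (MCHom u_nabla), (MCHom v_nabla).
Qed.

(** The matrix [A] of a connection lists the coordinates of the images of the
    basis in its rows and acts on row vectors from the right. This is the
    convention of [eigenvalue], which lets exponents be read off [A]. *)
Section ConstantConnection.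
Variables (R : comNzRingType) (X : mclog R) (n : nat) (e : 'I_n -> X).
Variables (coord : X -> 'rV[fps R]_n) (B : 'M[R]_n).
Hypotheses (eK : cancel (comb e) coord) (cK : cancel coord (comb e)).

Lemma nabla_comb (A : 'M[fps R]_n) :
    (forall i, nabla X (e i) = comb e (row i A)) ->
  forall c, nabla X (comb e c) = comb e (map_mx (@theta R) c + c *m A).
Proof.
move=> nablaA c; rewrite raddfD /= comb_mulmx /comb (raddf_sum (nabla X)).
rewrite -big_split; apply: eq_bigr => i _ /=.
by rewrite (nabla_leibniz (c 0 i)) nablaA mxE.
Qed.

Hypothesis nablaB : forall i,
  nabla X (e i) = comb e (row i (map_mx (@fpsC R) B)).

Local Notation T := (tensor (@fpsC R) (mod_x X)).
Local Notation pure := (@pure _ _ (@fpsC R) (mod_x X)).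

Let coord_linear : linear coord := can2_linear (f := comb e) eK cK.
Let coordL : {linear X -> 'rV[fps R]_n} :=
  HB.pack coord (GRing.isLinear.Build _ _ _ _ coord coord_linear).

Definition to_eul (m : X) : T := \sum_(i < n) pure (coord m 0 i) (proj_x (e i)).

Fact to_eul_is_linear : linear to_eul.
Proof.
move=> f m1 m2; rewrite /to_eul scaler_sumr -big_split /=.
by apply: eq_bigr => i _; rewrite pureZ -pureDl coord_linear !mxE.
Qed.
HB.instance Definition _ :=
  GRing.isLinear.Build (fps R) X T *:%R to_eul to_eul_is_linear.

(** The [R]-linear section of [M -> M / (x)] onto the [R]-span of the basis; it
    replaces coordinates of any representative by their constant terms. *)
Definition lift_x (p : mod_x X) : X :=
  \sum_(i < n) fpsC (const_coef (coord
    (repr (p : Quotient.quot (subzmod (imod (@ideal_x R) X)))) 0 i)) *: e i.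

Lemma lift_xE m : lift_x (proj_x m) =
  \sum_(i < n) fpsC (const_coef (coord m 0 i)) *: e i.
Proof.
rewrite /lift_x; set m' := repr _.
have : m' - m \in imod (@ideal_x R) X by apply/qproj_eq; exact: qproj_repr.
rewrite (mem_imod_basis _ eK cK) => /forallP mm'.
apply: eq_bigr => i _; congr (fpsC _ *: _); apply/eqP.
have := mm' i; rewrite mem_ideal_x -[coord _]/(coordL _) raddfB /= !mxE.
by rewrite raddfB subr_eq0.
Qed.

Lemma proj_xZ (f : fps R) (m : X) :
  proj_x (f *: m) = const_coef f *: proj_x m.
Proof.
rewrite -[RHS]/(fpsC (const_coef f) *: (qproj (imod (@ideal_x R) X) m)).
rewrite -linearZ; apply/qproj_eq; rewrite -scalerBl; apply: imod_gen.
by rewrite mem_ideal_x raddfB /= subrr.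
Qed.

Lemma proj_x_comb c :
  proj_x (comb e c) = \sum_(i < n) const_coef (c 0 i) *: proj_x (e i).
Proof.
rewrite /comb /proj_x (raddf_sum (qproj (imod (@ideal_x R) X))).
by apply: eq_bigr => i _; exact: proj_xZ.
Qed.

Lemma lift_xD p q : lift_x (p + q) = lift_x p + lift_x q.
Proof.
have [m1 ->] : exists m, p = proj_x m by exact: qproj_surj.
have [m2 ->] : exists m, q = proj_x m by exact: qproj_surj.
rewrite /proj_x -[LHS](congr1 lift_x (raddfD (qproj (imod (@ideal_x R) X)) m1 m2)).
rewrite !lift_xE -big_split; apply: eq_bigr => i _ /=.
by rewrite -[coord _]/(coordL _) raddfD !mxE !raddfD scalerDl.
Qed.

Lemma lift_xZ a p : lift_x (a *: p) = fpsC a *: lift_x p.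
Proof.
have [m ->] : exists m, p = proj_x m by exact: qproj_surj.
have -> : a *: proj_x m = proj_x (fpsC a *: m) by rewrite proj_xZ.
rewrite !lift_xE scaler_sumr; apply: eq_bigr => i _ /=.
by rewrite -[coord _]/(coordL _) linearZ mxE rmorphM rmorphM scalerA.
Qed.

Definition of_eul : T -> X := tens_lift (fun f p => f *: lift_x p).

Lemma of_eulE f p : of_eul (pure f p) = f *: lift_x p.
Proof.
apply: tens_liftE => [g h q|g q q'|g a q].
- by rewrite scalerDl.
- by rewrite lift_xD scalerDr.
- by rewrite lift_xZ scalerA.
Qed.

Lemma of_eulD t t' : of_eul (t + t') = of_eul t + of_eul t'.
Proof.
apply: tens_liftD => [g h q|g q q'|g a q].
- by rewrite scalerDl.
- by rewrite lift_xD scalerDr.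
- by rewrite lift_xZ scalerA.
Qed.

Lemma of_eul0 : of_eul 0 = 0.
Proof. by apply: (addrI (of_eul 0)); rewrite -of_eulD !addr0. Qed.

Lemma lift_x_basis i : lift_x (proj_x (e i)) = e i.
Proof.
rewrite lift_xE -[in RHS](comb_delta e i); apply: eq_bigr => j _.
rewrite -(comb_delta e i) eK mxE eqxx /=.
by case: eqP => _; rewrite ?rmorph1 ?rmorph0.
Qed.

Lemma to_eulK : cancel to_eul of_eul.
Proof.
move=> m; rewrite -[RHS]cK /to_eul (big_morph of_eul of_eulD of_eul0).
by apply: eq_bigr => i _; rewrite of_eulE lift_x_basis.
Qed.

Lemma of_eulK : cancel of_eul to_eul.
Proof.
elim/tensor_ind => [|f p t IHt]; first by rewrite of_eul0 raddf0.
rewrite of_eulD raddfD /= IHt; congr (_ + _).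
have [m ->] : exists m, p = proj_x m by exact: qproj_surj.
rewrite of_eulE linearZ /= lift_xE (linear_sum to_eul) scaler_sumr.
have -> : proj_x m = \sum_(i < n) const_coef (coord m 0 i) *: proj_x (e i).
  by rewrite -proj_x_comb cK.
rewrite pure_sumr; apply: eq_bigr => i _.
rewrite linearZ /= /to_eul (bigD1 i) //= big1 => [|j ji].
  rewrite -(comb_delta e i) eK mxE !eqxx addr0 !pureZ mulr1 pure_bal.
  by rewrite comb_delta.
by rewrite -(comb_delta e i) eK mxE (negPf ji) andbF pure0l.
Qed.

Lemma to_eul_nabla m : to_eul (nabla X m) = eul_nabla (res X) (to_eul m).
Proof.
rewrite -[in LHS](cK m) (nabla_comb nablaB) /to_eul eK.
rewrite (big_morph (eul_nabla (res X)) (eul_nablaD (res X)) (id1 := 0)); last first.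
  by apply: (addrI (eul_nabla (res X) (0 : T))); rewrite -eul_nablaD !addr0.
under [RHS]eq_bigr do rewrite eul_nablaE /= resE nablaB proj_x_comb pure_sumr.
under [LHS]eq_bigr do rewrite !mxE pureDl.
rewrite !big_split /=; congr (_ + _).
rewrite exchange_big /=; apply: eq_bigr => j _.
rewrite (big_morph (fun f => pure f (proj_x (e j)))
  (fun f g => pureDl _ f g _) (pure0l _ _)); apply: eq_bigr => i _.
by rewrite !mxE pure_bal.
Qed.

(** The inverse of [to_eul] sends [f (x) p] to [f] times the lift of [p]. *)
Lemma constant_connection_eul : mc_iso X (eul (res X) (mod_x_fin_gen X)).
Proof.
exact: (@mc_iso_of_inverse _ X (eul (res X) (mod_x_fin_gen X)) to_eul of_eul
  to_eul_nabla to_eulK of_eulK).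
Qed.

End ConstantConnection.

(** * The residue field and the exponents *)

Section ResidueField.
Variables (C : fieldType) (R : comAlgType C) (r : {pred R}).
Hypotheses (r_ideal : idealr_closed r) (R_complete : adically_complete r).
Hypothesis R_residue : residue_field_is_base r.

(** The inverse is the limit [l] of the geometric sums: [(1 - m) l - 1] lies in
    all powers of the ideal, as does [0], so uniqueness of limits identifies
    them. *)
Lemma exists_inverse_1B m : m \in r -> exists b, (1 - m) * b = 1.
Proof.
move=> mr.
have powM n a : a \in ideal_pow r n -> forall b, b * a \in ideal_pow r n.
  by case: n => // n an b; apply: (@rpredZ _ _ (imod _ R^o)).
have powB n a b : a \in ideal_pow r n -> b \in ideal_pow r n ->
    a - b \in ideal_pow r n.
  by case: n => // n an bn; apply: (@rpredB _ (imod _ R^o)).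
have m_pow n : m ^+ n \in ideal_pow r n.
  elim: n => // n IHn; rewrite exprS; apply: mem_ideal_gen.
  by apply/asboolP; exists m, (m ^+ n).
have [|l [lP _]] := R_complete (u := fun n => \sum_(i < n) m ^+ i).
  by move=> n /=; rewrite big_ord_recr /= addrAC subrr add0r.
(* Limits of the zero sequence are elements of all powers of the ideal. *)
have [|z [_ z_uniq]] := R_complete (u := fun=> 0).
  by move=> n; rewrite subrr -(subrr (m ^+ n)); apply: powB.
exists l; apply/eqP; rewrite -subr_eq0; apply/eqP.
transitivity z; [symmetry|]; apply: z_uniq => n; rewrite subr0; last first.
  by rewrite -(subrr (m ^+ n)); apply: powB.
suff -> : (1 - m) * l - 1 = (1 - m) * (l - \sum_(i < n) m ^+ i) - m ^+ n.
  by apply: powB; first exact: powM.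
have geom : (1 - m) * \sum_(i < n) m ^+ i = 1 - m ^+ n.
  by rewrite -opprB mulNr -subrX1 opprB.
by rewrite mulrBr geom opprB -addrA [_ - 1 - _]addrAC subrr add0r.
Qed.

Lemma reduceE a c : (reduce r a = c) <-> (a - c%:A \in r).
Proof.
have [d [dP d_uniq]] := R_residue a.
have -> : reduce r a = d.
  rewrite /reduce; case: pselect => [ex|[]]; last by exists d.
  by case: cid => d' /= /d_uniq.
by split=> [<-|/d_uniq].
Qed.

Lemma reduction_morphism : exists phi : {rmorphism R -> C},
  [/\ forall a, phi a = reduce r a, forall c, phi c%:A = c,
      forall a, (phi a == 0) = (a \in r)
    & forall a, phi a != 0 -> exists b, a * b = 1].
Proof.
have [r0 _ rM] := r_ideal.
have rD a b : a \in r -> b \in r -> a + b \in r.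
  by move=> ar br; rewrite -[a]mul1r; apply: rM.
have rZ a b : b \in r -> a * b \in r.
  by move=> br; rewrite -[_ * _]addr0; apply: rM.
have redP a : a - (reduce r a)%:A \in r by apply/reduceE.
have redB : zmod_morphism (reduce r).
  move=> a b; apply/reduceE; rewrite scalerBl.
  have -> : a - b - ((reduce r a)%:A - (reduce r b)%:A) =
      (a - (reduce r a)%:A) + (-1) * (b - (reduce r b)%:A).
    by rewrite mulN1r !opprB addrACA [RHS]addrACA [- b + _]addrC.
  by apply: rD => //; apply: rZ.
have redM : monoid_morphism (reduce r).
  split=> [|a b]; apply/reduceE; first by rewrite scale1r subrr.
  have -> : a * b - (reduce r a * reduce r b)%:A =
      b * (a - (reduce r a)%:A) + (reduce r a)%:A * (b - (reduce r b)%:A).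
    rewrite !mulrBr [b * a]mulrC [b * _%:A]mulrC addrA subrK.
    by rewrite -scalerAl mul1r scalerA.
  by apply: rD; apply: rZ.
pose phi : {rmorphism R -> C} := HB.pack (reduce r)
  (GRing.isZmodMorphism.Build _ _ _ redB)
  (GRing.isMonoidMorphism.Build _ _ _ redM).
have phi0 a : (phi a == 0) = (a \in r).
  apply/eqP/idP => [/reduceE|ar]; first by rewrite scale0r subr0.
  by apply/reduceE; rewrite scale0r subr0.
exists phi; split=> // [c|a a0]; first by apply/reduceE; rewrite subrr.
have := redP a; rewrite -[reduce r a]/(phi a); set c := phi a in a0 * => ar.
(* [a = c (1 - m)] with [c] the residue of [a]. *)
have [|b bP] := @exists_inverse_1B (- (c^-1%:A * (a - c%:A))).
  by rewrite -mulN1r; apply/rZ/rZ.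
exists (c^-1%:A * b); rewrite -[RHS]bP opprK mulrBr.
rewrite -[c^-1%:A * c%:A]scalerAl mul1r scalerA mulVf // scale1r addrC subrK.
by rewrite mulrA [a * _]mulrC.
Qed.

Section Exponents.
Variables (phi : {rmorphism R -> C}).
Hypothesis phi_base : forall c, phi c%:A = c.
Hypothesis phi_ker : forall a, (phi a == 0) = (a \in r).

Lemma mem_ideal_rx (f : fps R) : (f \in ideal_rx r) = (phi (const_coef f) == 0).
Proof.
apply/idP/idP => [/imodP[s sI ->]|f0]; last first.
  rewrite (fps_decomp f); apply: (@rpredD _ (imod _ (fps R)^o)).
    apply: mem_ideal_gen; apply/asboolP; right.
    by exists (fcoef f 0); rewrite // -phi_ker.
  by rewrite mulrC; apply: mem_ideal_gen_mul; apply/asboolP; left.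
rewrite !raddf_sum big_seq big1 // => p ps.
rewrite [LHS](congr1 phi (rmorphM const_coef p.1 p.2)) rmorphM /=.
have /asboolP[->|[a ar ->]] := allP sI _ ps.
  by rewrite [const_coef (fpsX R)](_ : _ = 0) // rmorph0 mul0r.
by move: ar; rewrite -phi_ker => /eqP a0; rewrite /const_coef /= a0 mul0r.
Qed.

(** An eigenvector over [C], lifted to constant coordinates in the basis, is an
    eigenvector of the reduced residue; it is nonzero because membership in
    [(r, x) M] is tested on coordinates. *)
Lemma eigenvalue_exponent (X : mclog R) n (e : 'I_n -> X) (A : 'M[fps R]_n) :
    bijective (comb e) -> (forall i, nabla X (e i) = comb e (row i A)) ->
  forall c, eigenvalue (map_mx phi (mxcoef 0 A)) c -> exponent r X c.
Proof.
move=> [coord eK cK] nablaA c /eigenvalueP[v vA v0].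
pose w : 'rV[fps R]_n := map_mx (fun a => fpsC a%:A) v.
have phi_w i : phi (const_coef (w 0 i)) = v 0 i.
  by rewrite mxE /const_coef /= phi_base.
exists (proj_rx r (comb e w)).
  apply: contraNneq v0 => w0; apply/eqP/rowP => i; rewrite mxE -phi_w.
  have : comb e w - 0 \in imod (ideal_rx r) X.
    by apply/qproj_eq; rewrite -[LHS]/(proj_rx r _) w0 (raddf0 (qproj _)).
  rewrite subr0 (mem_imod_basis _ eK cK) eK => /forallP/(_ i).
  by rewrite mem_ideal_rx => /eqP.
rewrite res_barE (nabla_comb nablaA).
rewrite -[RHS]/(fpsC c%:A *: qproj (imod (ideal_rx r) X) (comb e w)) -linearZ.
apply/qproj_eq; rewrite -linearZ -linearB (mem_imod_basis _ eK cK) eK.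
apply/forallP => j; rewrite mem_ideal_rx !mxE.
rewrite [theta _](_ : _ = 0) ?add0r ?thetaC // !rmorphB.
rewrite -!/(const_coef _) !rmorphM /=.
rewrite !phi_base subr_eq0.
have /rowP/(_ j) := vA; rewrite !mxE => <-; rewrite !rmorph_sum.
by apply/eqP/eq_bigr => i _; rewrite !mxE !rmorphM /= phi_base.
Qed.

End Exponents.
End ResidueField.

(** * The theorem *)

Lemma no_integer_gap_sub (C : fieldType) (P Q : C -> Prop) :
  (forall c, P c -> Q c) -> no_integer_gap Q -> no_integer_gap P.
Proof. by move=> PQ gapQ c d /PQ Qc /PQ Qd; exact: gapQ. Qed.

(** The new basis is [Q^-1 e]. Differentiating [Q^-1 Q = 1] gives
    [theta (Q^-1) + Q^-1 A = B Q^-1], which says that the connection acts on it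
    by [B]. *)
Lemma constant_basis (R : comNzRingType) (X : mclog R) n (e : 'I_n -> X)
    (A Q : 'M[fps R]_n) (B : 'M[R]_n) :
    bijective (comb e) -> (forall i, nabla X (e i) = comb e (row i A)) ->
    Q \in unitmx -> map_mx (@theta R) Q = A *m Q - Q *m map_mx (@fpsC R) B ->
  let e' i := comb e (row i (invmx Q)) in
  bijective (comb e') /\
  (forall i, nabla X (e' i) = comb e' (row i (map_mx (@fpsC R) B))).
Proof.
move=> [coord eK cK] nablaA uQ dQ e'; set B' := map_mx _ B in dQ *.
have e'E c : comb e' c = comb e (c *m invmx Q) by rewrite comb_mulmx.
split.
  exists (fun m => coord m *m Q) => [c|m]; first by rewrite e'E eK mulmxKV.
  by rewrite e'E mulmxK.
have dQV : map_mx (@theta R) (invmx Q) + invmx Q *m A = B' *m invmx Q.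
  have := theta_mulmx (invmx Q) Q; rewrite mulVmx // dQ mulmxBr mulKmx //.
  rewrite (_ : map_mx _ 1%:M = 0); last first.
    apply/matrixP => a b; rewrite !mxE -(rmorph_nat (@fpsC R)).
    exact: thetaC.
  rewrite addrA mulmxA -mulmxDl => /esym/eqP.
  by rewrite subr_eq0 => /eqP <-; rewrite mulmxK.
move=> i; rewrite e'E (nabla_comb nablaA) -[in RHS]row_mul -dQV.
by rewrite [row i (_ + _)]linearD /= row_mul map_row.
Qed.

Theorem theorem8p10 (C : closedFieldType) (charC : [pchar C] =i pred0)
    (R : comAlgType C) (r : {pred R})
    (R_local : local_ring_with r) (R_noetherian : noetherian_ring R)
    (R_complete : adically_complete r) (R_residue : residue_field_is_base r) :
  (forall X : mclog R,
     free_module X ->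
     no_integer_gap (exponent r X) ->
     mc_iso X (eul (res X) (mod_x_fin_gen X)))
  /\
  (forall (n : nat) (A : 'M[fps R]_n),
     no_integer_gap
       (eigenvalue (map_mx (fun f : fps R => reduce r (fcoef f 0)) A)) ->
     exists2 P : 'M[fps R]_n, P \in unitmx &
     exists B : 'M[R]_n, gauge A P = map_mx (@fpsC R) B).
Proof.
have [[r_ideal _] _] := R_local.
have [phi [phiE phi_base phi_ker phi_local]] :=
  reduction_morphism r_ideal R_complete R_residue.
split=> [X X_free gapX|n A gapA].
  have [n [e e_bij]] := fin_free_basis (mc_fin_gen X) X_free.
  have [coord eK cK] := e_bij.
  pose A := \matrix_i coord (nabla X (e i)).
  have nablaA i : nabla X (e i) = comb e (row i A) by rewrite rowK cK.
  have [|Q uQ dQ] := gauge_to_const phi_local charC (A := A).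
    apply: no_integer_gap_sub gapX => c.
    exact: eigenvalue_exponent phi_base phi_ker _ _ _ _ e_bij nablaA c.
  have [[coord' e'K c'K] nablaB] := constant_basis e_bij nablaA uQ dQ.
  exact: constant_connection_eul e'K c'K nablaB.
have [|P uP dP] := gauge_to_const phi_local charC (A := A).
  rewrite [map_mx phi _](_ : _ = map_mx (fun f => reduce r (fcoef f 0)) A) //.
  by apply/matrixP => i j; rewrite !mxE phiE.
exists P => //; exists (mxcoef 0 A).
by rewrite /gauge dP opprB addrC subrK mulKmx.
Qed.
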